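(* Let $\mathscr{A}\in\mathbb{R}^{I_1\times\cdots\times I_M\times I_1\times\cdots\times I_M}$, $\mathscr{C}\in\mathbb{R}^{J_1\times\cdots\times J_N\times J_1\times\cdots\times J_N}$ and $\mathscr{D}\in\mathbb{R}^{I_1\times\cdots\times I_M\times J_1\times\cdots\times J_N}$, and assume that the Sylvester tensor equation $\mathscr{A}*_M\mathscr{X}+\mathscr{X}*_N\mathscr{C}=\mathscr{D}$ is consistent, i.e. has a solution $\mathscr{X}\in\mathbb{R}^{I_1\times\cdots\times I_M\times J_1\times\cdots\times J_N}$. Let the initial iteration tensor be $\mathscr{X}^{(1)}=\mathscr{A}^T*_M\mathscr{W}+\mathscr{W}*_N\mathscr{C}^T$ with arbitrary $\mathscr{W}\in\mathbb{R}^{I_1\times\cdots\times I_M\times J_1\times\cdots\times J_N}$ (or, especially, $\mathscr{X}^{(1)}=\mathscr{O}$, the zero tensor). Then the solution of the equation generated by Algorithm G (defined in the context), in exact arithmetic, is the unique solution of least Frobenius norm among all solutions of the equation.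
   Context: Einstein product: for $\mathscr{A}\in\mathbb{R}^{I_1\times\cdots\times I_M\times J_1\times\cdots\times J_N}$ and $\mathscr{B}\in\mathbb{R}^{J_1\times\cdots\times J_N\times K_1\times\cdots\times K_L}$, $(\mathscr{A}*_N\mathscr{B})_{i_1\dots i_Mk_1\dots k_L}=\sum_{j_1,\dots,j_N}\mathscr{A}_{i_1\dots i_Mj_1\dots j_N}\mathscr{B}_{j_1\dots j_Nk_1\dots k_L}$; the subscript of $*$ is the number of contracted modes. Transpose: for $\mathscr{A}\in\mathbb{R}^{I_1\times\cdots\times I_M\times J_1\times\cdots\times J_N}$, $\mathscr{A}^T\in\mathbb{R}^{J_1\times\cdots\times J_N\times I_1\times\cdots\times I_M}$ with $(\mathscr{A}^T)_{j_1\dots j_Ni_1\dots i_M}=\mathscr{A}_{i_1\dots i_Mj_1\dots j_N}$. $\|\cdot\|$ is the Frobenius norm (square root of the sum of squares of all entries). Algorithm G (input $\mathscr{A},\mathscr{C},\mathscr{D}$ and an initial tensor $\mathscr{X}^{(1)}$): set $\mathscr{R}^{(1)}=\mathscr{D}-\mathscr{A}*_M\mathscr{X}^{(1)}-\mathscr{X}^{(1)}*_N\mathscr{C}$ and $\mathscr{P}^{(1)}=\mathscr{A}^T*_M\mathscr{R}^{(1)}+\mathscr{R}^{(1)}*_N\mathscr{C}^T$. For $k=1,2,\dots$: if $\mathscr{R}^{(k)}=0$, or if $\mathscr{R}^{(k)}\ne0$ and $\mathscr{P}^{(k)}=0$, stop; otherwise set $$\mathscr{X}^{(k+1)}=\mathscr{X}^{(k)}+\frac{\|\mathscr{R}^{(k)}\|^2}{\|\mathscr{P}^{(k)}\|^2}\mathscr{P}^{(k)},\qquad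 \mathscr{R}^{(k+1)}=\mathscr{D}-\mathscr{A}*_M\mathscr{X}^{(k+1)}-\mathscr{X}^{(k+1)}*_N\mathscr{C},$$ $$\mathscr{P}^{(k+1)}=\mathscr{A}^T*_M\mathscr{R}^{(k+1)}+\mathscr{R}^{(k+1)}*_N\mathscr{C}^T+\frac{\|\mathscr{R}^{(k+1)}\|^2}{\|\mathscr{R}^{(k)}\|^2}\mathscr{P}^{(k)}.$$ The solution generated by the algorithm is the iterate $\mathscr{X}^{(k)}$ at which it stops with $\mathscr{R}^{(k)}=0$. *)

(* Defs.v *)
From HB Require Import structures.
From mathcomp Require Import all_boot all_order all_algebra.
From mathcomp Require Import reals.

Set Implicit Arguments.
Unset Strict Implicit.
Unset Printing Implicit Defensive.

Import Order.TTheory GRing.Theory Num.Theory.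
Local Open Scope ring_scope.

(* Multi-indices (i_1, ..., i_M) with 0 <= i_k < I_k (indexing is 0-based). *)
Notation midx I := {dffun forall k, 'I_(I k)}.

(* R^(I_1 x ... x I_M x J_1 x ... x J_N), with the two groups of modes kept
   apart: the entry with indices i_1 ... i_M j_1 ... j_N is T (i, j).  Entries
   are typed in R^o only to get the library's scaling a *: T. *)
Definition tensor (R : realType) {M N : nat} (I : 'I_M -> nat)
    (J : 'I_N -> nat) : Type := {ffun midx I * midx J -> R^o}.

HB.instance Definition _ (R : realType) (M N : nat) (I : 'I_M -> nat)
    (J : 'I_N -> nat) := Vector.copy (tensor R I J)
  {ffun midx I * midx J -> R^o}.

Section Tensors.
Context {R : realType}.

Definition einstein {M N L : nat} {I : 'I_M -> nat} {J : 'I_N -> nat}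
    {K : 'I_L -> nat} (A : tensor R I J) (B : tensor R J K) : tensor R I K :=
  [ffun p => \sum_(j : midx J) A (p.1, j) * B (j, p.2)].

Definition ttr {M N : nat} {I : 'I_M -> nat} {J : 'I_N -> nat}
    (A : tensor R I J) : tensor R J I :=
  [ffun p => A (p.2, p.1)].

Definition fnorm {M N : nat} {I : 'I_M -> nat} {J : 'I_N -> nat}
    (A : tensor R I J) : R :=
  Num.sqrt (\sum_(p : midx I * midx J) (A p : R) ^+ 2).

End Tensors.

(* The subscript of the Einstein product (the number of contracted modes) is
   determined by the types of the arguments. *)
Notation "A *e B" := (einstein A B) (at level 40, left associativity).

Section Sylvester.
Context {R : realType} {M N : nat} {I : 'I_M -> nat} {J : 'I_N -> nat}.
Variables (A : tensor R I I) (C : tensor R J J) (D : tensor R I J).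

Definition sylvester_solution (X : tensor R I J) : Prop :=
  A *e X + X *e C = D.

Definition least_norm_solution (X : tensor R I J) : Prop :=
  sylvester_solution X /\
  forall Y : tensor R I J, sylvester_solution Y -> fnorm X <= fnorm Y.

(* One stage (X^(k), R^(k), P^(k)) of the algorithm. *)
Record stage := Stage {
  iterate : tensor R I J;
  residual : tensor R I J;
  direction : tensor R I J }.

Definition residual_of (X : tensor R I J) : tensor R I J :=
  D - A *e X - X *e C.

Definition gradient_of (Q : tensor R I J) : tensor R I J :=
  ttr A *e Q + Q *e ttr C.

Definition algG_init (X1 : tensor R I J) : stage :=
  let R1 := residual_of X1 in Stage X1 R1 (gradient_of R1).

Definition algG_stop (s : stage) : Prop :=
  residual s = 0 \/ (residual s <> 0 /\ direction s = 0).

Definition algG_step (s : stage) : stage :=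
  let: Stage Xk Rk Pk := s in
  let X' := Xk + (fnorm Rk ^+ 2 / fnorm Pk ^+ 2) *: Pk in
  let R' := residual_of X' in
  let P' := gradient_of R' + (fnorm R' ^+ 2 / fnorm Rk ^+ 2) *: Pk in
  Stage X' R' P'.

(* [algG_run X1 k s]: started at X1, the algorithm reaches iteration k (it has
   not stopped before), and s is its k-th stage. *)
Inductive algG_run (X1 : tensor R I J) : nat -> stage -> Prop :=
| algG_run1 : algG_run X1 1 (algG_init X1)
| algG_runS k s : algG_run X1 k s -> ~ algG_stop s ->
    algG_run X1 k.+1 (algG_step s).

Definition algG_generates (X1 X : tensor R I J) : Prop :=
  exists k s, [/\ algG_run X1 k s, algG_stop s, residual s = 0 &
                  X = iterate s].

End Sylvester.

(* Main.v *)
Require Import Defs.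
From HB Require Import structures.
From mathcomp Require Import all_boot all_order all_algebra.
From mathcomp Require Import reals.
Local Open Scope ring_scope.

(** Write L X = A * X + X * C for the Sylvester operator and <., .> for the
    entrywise inner product.  The map Q |-> A^T * Q + Q * C^T is the adjoint L*
    of L ([inner_adjoint]), so that the algorithm is a conjugate gradient
    iteration for L X = D in which both the residuals and the directions are
    pairwise orthogonal ([stage_orthogonal]).

    Termination.  For a solution S, the error S - X_k satisfies
    <P_k, S - X_k> = |R_k|^2 ([inner_direction_error]); hence P_k vanishes only
    together with R_k, and the algorithm cannot stop at a nonzero residual.
    Directions being pairwise orthogonal, they cannot all be nonzero in a space
    of finite dimension ([orthogonal_seq_vanishes]), so some residual is zero.

    Least norm.  Every direction, and by the choice of X_1 every iterate, lies in
    the range of L*, which is the orthogonal complement of the kernel of L.  Two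
    solutions differ by an element of that kernel; by Pythagoras a solution in
    the range of L* is therefore strictly shorter than every other solution
    ([range_solution_norm]).  This also shows that the algorithm has
    only one possible output. *)

Set Implicit Arguments.
Unset Strict Implicit.
Unset Printing Implicit Defensive.

Import Order.TTheory GRing.Theory Num.Theory.

(** * The entrywise inner product of tensors *)

Section Inner.
Context {R : realType} {M N : nat} {I : 'I_M -> nat} {J : 'I_N -> nat}.
Implicit Types (T U : tensor R I J) (a : R).

Definition inner T U : R := \sum_p (T p : R) * U p.

Lemma innerE T U :
  inner T U = \sum_(i : midx I) \sum_(j : midx J) (T (i, j) : R) * U (i, j).
Proof. by rewrite pair_bigA; apply: eq_bigr => -[]. Qed.

Lemma innerC T U : inner T U = inner U T.
Proof. by apply: eq_bigr => p _; rewrite mulrC. Qed.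

Lemma innerDl T1 T2 U : inner (T1 + T2) U = inner T1 U + inner T2 U.
Proof. by rewrite -big_split; apply: eq_bigr => p _; rewrite ffunE mulrDl. Qed.

Lemma innerZl a T U : inner (a *: T) U = a * inner T U.
Proof. by rewrite big_distrr; apply: eq_bigr => p _; rewrite ffunE /= -mulrA. Qed.

Lemma innerDr T U1 U2 : inner T (U1 + U2) = inner T U1 + inner T U2.
Proof. by rewrite innerC innerDl !(innerC _ T). Qed.

Lemma innerZr a T U : inner T (a *: U) = a * inner T U.
Proof. by rewrite innerC innerZl innerC. Qed.

Lemma inner0l U : inner 0 U = 0.
Proof. by rewrite -(scale0r (0 : tensor R I J)) innerZl mul0r. Qed.

Lemma inner0r T : inner T 0 = 0.
Proof. by rewrite innerC inner0l. Qed.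

Lemma innerBr T U1 U2 : inner T (U1 - U2) = inner T U1 - inner T U2.
Proof. by rewrite innerDr -scaleN1r innerZr mulN1r. Qed.

Lemma innerBl T1 T2 U : inner (T1 - T2) U = inner T1 U - inner T2 U.
Proof. by rewrite innerC innerBr !(innerC U). Qed.

Lemma inner_pythagoras T U :
  inner T U = 0 -> inner (T + U) (T + U) = inner T T + inner U U.
Proof. by move=> TU0; rewrite innerDr !innerDl (innerC U) TU0 addr0 add0r. Qed.

Lemma inner_ge0 T : 0 <= inner T T.
Proof. by apply: sumr_ge0 => p _; rewrite -expr2 sqr_ge0. Qed.

Lemma inner_eq0 T : (inner T T == 0) = (T == 0).
Proof.
apply/idP/eqP => [|->]; last by rewrite inner0l.
rewrite psumr_eq0 => [/allP T0|p _]; last by rewrite -expr2 sqr_ge0.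
apply/ffunP => p; rewrite ffunE.
by have := T0 p (mem_index_enum p); rewrite /= mulf_eq0 orbb => /eqP.
Qed.

Lemma fnorm_sqr T : fnorm T ^+ 2 = inner T T.
Proof.
rewrite sqr_sqrtr; last by apply: sumr_ge0 => p _; rewrite sqr_ge0.
by apply: eq_bigr => p _; rewrite expr2.
Qed.

Lemma ler_fnorm T U : (fnorm T <= fnorm U) = (inner T T <= inner U U).
Proof. by rewrite -!fnorm_sqr ler_sqr // nnegrE sqrtr_ge0. Qed.

(** A nonzero vector orthogonal to its predecessors is not in their span, so n
    nonzero terms span a subspace of dimension n; this stops being possible once
    n exceeds the dimension of the space. *)
Lemma orthogonal_seq_vanishes (v : nat -> tensor R I J) :
  (forall i j, (i < j)%N -> inner (v j) (v i) = 0) -> exists n, v n = 0.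
Proof.
move=> ortho; set m := (\dim {: tensor R I J}).+1.
case: (boolP [exists n : 'I_m, v n == 0]) => [/existsP[n /eqP]|].
  by exists n.
rewrite negb_exists => /forallP v_neq0; exfalso.
(* The list is reversed because freeness is decomposed from its head. *)
have free_v n : (n <= m)%N -> free (rev (map v (iota 0 n))).
  elim: n => [|n IHn] lt_nm; first exact: nil_free.
  rewrite -addn1 iotaD map_cat rev_cat /= free_cons add0n IHn ?(ltnW lt_nm) // andbT.
  apply: contra (v_neq0 (Ordinal lt_nm)) => /= v_span; rewrite -inner_eq0.
  rewrite [X in inner _ X](coord_span (X := in_tuple _) v_span).
  apply/eqP; elim/big_ind: _ => [|x y x0 y0|i _].
  - by rewrite inner0r.
  - by rewrite innerDr x0 y0 addr0.
  have : (rev (map v (iota 0 n)))`_i \in rev (map v (iota 0 n)) by exact: mem_nth.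
  rewrite mem_rev => /mapP[j]; rewrite mem_iota => /andP[_ lt_jn] /= ->.
  by rewrite innerZr ortho ?mulr0.
have /eqP dim_v := free_v m (leqnn m).
have := dimvS (subvf <<rev (map v (iota 0 m))>>).
by rewrite dim_v size_rev size_map size_iota ltnn.
Qed.

End Inner.

(** * The Sylvester operator and its adjoint *)

Section Einstein.
Context {R : realType} {M N L : nat}.
Context {I : 'I_M -> nat} {J : 'I_N -> nat} {K : 'I_L -> nat}.
Implicit Types (A : tensor R I J) (B : tensor R J K) (T : tensor R I K).

Lemma einsteinDZl a A1 A2 B :
  (a *: A1 + A2) *e B = a *: (A1 *e B) + A2 *e B.
Proof.
apply/ffunP => p; rewrite !ffunE scaler_sumr -big_split.
by apply: eq_bigr => j _; rewrite !ffunE mulrDl -scalerAl.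
Qed.

Lemma einsteinDZr a A B1 B2 :
  A *e (a *: B1 + B2) = a *: (A *e B1) + A *e B2.
Proof.
apply/ffunP => p; rewrite !ffunE scaler_sumr -big_split.
by apply: eq_bigr => j _; rewrite !ffunE mulrDr -scalerAr.
Qed.

Lemma inner_einstein_l A B T : inner (A *e B) T = inner B (ttr A *e T).
Proof.
rewrite !innerE exchange_big [RHS]exchange_big; apply: eq_bigr => k _.
under eq_bigr => i _ do rewrite ffunE big_distrl.
under [RHS]eq_bigr => j _ do rewrite ffunE big_distrr.
rewrite exchange_big; apply: eq_bigr => j _; apply: eq_bigr => i _ /=.
by rewrite ffunE /= mulrCA mulrA.
Qed.

Lemma inner_einstein_r A B T : inner (A *e B) T = inner A (T *e ttr B).
Proof.
rewrite !innerE; apply: eq_bigr => i _.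
under eq_bigr => k _ do rewrite ffunE big_distrl.
under [RHS]eq_bigr => j _ do rewrite ffunE big_distrr.
rewrite exchange_big; apply: eq_bigr => j _; apply: eq_bigr => k _ /=.
by rewrite ffunE /= -mulrA [T _ * _]mulrC.
Qed.

End Einstein.

Section SylvesterOperator.
Context {R : realType} {M N : nat} {I : 'I_M -> nat} {J : 'I_N -> nat}.
Implicit Types (A : tensor R I I) (C : tensor R J J) (D : tensor R I J).

Definition sylvester A C (X : tensor R I J) : tensor R I J := A *e X + X *e C.

Fact sylvester_is_linear A C : linear (sylvester A C).
Proof.
by move=> a X Y; rewrite /sylvester einsteinDZl einsteinDZr scalerDr addrACA.
Qed.

HB.instance Definition _ A C :=
  GRing.isLinear.Build R _ _ _ (sylvester A C) (sylvester_is_linear A C).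

Lemma gradient_of_sylvester A C :
  gradient_of A C = sylvester (ttr A) (ttr C).
Proof. by []. Qed.

Lemma residual_of_sylvester A C D X : residual_of A C D X = D - sylvester A C X.
Proof. by rewrite /residual_of /sylvester opprD addrA. Qed.

Lemma inner_adjoint A C X Y :
  inner (sylvester A C X) Y = inner X (gradient_of A C Y).
Proof. by rewrite innerDl inner_einstein_l inner_einstein_r innerDr. Qed.

(** The difference of two solutions is in the kernel of the operator, hence
    orthogonal to the range of the adjoint: the identity is Pythagoras. *)
Lemma range_solution_norm A C D W Y :
    sylvester_solution A C D (gradient_of A C W) ->
    sylvester_solution A C D Y ->
  inner Y Y = inner (gradient_of A C W) (gradient_of A C W)
              + inner (Y - gradient_of A C W) (Y - gradient_of A C W).
Proof.
set X := gradient_of A C W => solX solY.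
have ker : sylvester A C (Y - X) = 0.
  by rewrite linearB -[RHS](subrr D) -{1}solY -solX.
have YX0 : inner (Y - X) X = 0 by rewrite -inner_adjoint ker inner0l.
by rewrite [RHS]addrC -inner_pythagoras // subrK.
Qed.

Lemma range_solution_least_norm A C D W :
    sylvester_solution A C D (gradient_of A C W) ->
  unique (least_norm_solution A C D) (gradient_of A C W).
Proof.
move=> solX; have pyth := range_solution_norm solX.
split=> [|Y [solY minY]].
  split=> // Y solY; rewrite ler_fnorm (pyth Y solY) lerDl; exact: inner_ge0.
have := minY _ solX; rewrite ler_fnorm (pyth Y solY) gerDl => le0.
apply/esym/eqP; rewrite -subr_eq0 -inner_eq0.
by rewrite eq_le le0 inner_ge0.
Qed.

End SylvesterOperator.

(** * The stages of the algorithm *)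

Section AlgorithmG.
Context {R : realType} {M N : nat} {I : 'I_M -> nat} {J : 'I_N -> nat}.
Variables (A : tensor R I I) (C : tensor R J J) (D X1 : tensor R I J).

(** The run of the algorithm with the stopping test removed, numbered from 0.
    Since 0^-1 = 0, all later residuals and directions are zero once a residual
    vanishes, so that the orthogonality relations hold for all stages. *)
Definition algG_stage k : stage := iter k (algG_step A C D) (algG_init A C D X1).

Local Notation Xk k := (iterate (algG_stage k)).
Local Notation Rk k := (residual (algG_stage k)).
Local Notation Pk k := (direction (algG_stage k)).
Local Notation L := (sylvester A C).
Local Notation Lt := (gradient_of A C).
Local Notation alpha k := (fnorm (Rk k) ^+ 2 / fnorm (Pk k) ^+ 2).
Local Notation beta k := (fnorm (Rk k.+1) ^+ 2 / fnorm (Rk k) ^+ 2).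

Lemma iterateS k : Xk k.+1 = Xk k + alpha k *: Pk k.
Proof. by rewrite /algG_stage iterS; case: (iter k _ _). Qed.

Lemma residualE k : Rk k = D - L (Xk k).
Proof.
rewrite -residual_of_sylvester.
by case: k => // k; rewrite /algG_stage iterS; case: (iter k _ _).
Qed.

Lemma residualS k : Rk k.+1 = Rk k - alpha k *: L (Pk k).
Proof.
rewrite [LHS]residualE iterateS (linearD (sylvester A C)) linearZ opprD addrA.
by rewrite -residualE.
Qed.

Lemma direction0 : Pk 0 = Lt (Rk 0).
Proof. by []. Qed.

Lemma directionS k : Pk k.+1 = Lt (Rk k.+1) + beta k *: Pk k.
Proof. by rewrite /algG_stage iterS; case: (iter k _ _). Qed.

Lemma direction_eq0_of_residual k : Rk k = 0 -> Pk k = 0.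
Proof.
case: k => [|k] R0; first by rewrite direction0 R0 gradient_of_sylvester linear0.
rewrite directionS R0 gradient_of_sylvester linear0 add0r fnorm_sqr inner0l.
by rewrite mul0r scale0r.
Qed.

Lemma direction_range k : exists W, Pk k = Lt W.
Proof.
elim: k => [|k [W PkW]]; first by exists (Rk 0).
exists (beta k *: W + Rk k.+1).
by rewrite directionS PkW !gradient_of_sylvester linearP addrC.
Qed.

Lemma iterate_range k : (exists W, X1 = Lt W) -> exists W, Xk k = Lt W.
Proof.
move=> X1_range; elim: k => [//|k [W XkW]].
have [U PkU] := direction_range k.
exists (alpha k *: U + W).
by rewrite iterateS XkW PkU !gradient_of_sylvester linearP addrC.
Qed.

Section Consistent.
Variable S : tensor R I J.
Hypothesis solS : sylvester_solution A C D S.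

Lemma residual_error k : Rk k = L (S - Xk k).
Proof. by rewrite residualE linearB -solS. Qed.

(** The step length makes the new error orthogonal to the last direction, so that
    only the gradient part of the next direction contributes, and
    <L* R, E> = <R, L E> = |R|^2. *)
Lemma inner_direction_error k : inner (Pk k) (S - Xk k) = inner (Rk k) (Rk k).
Proof.
have grad j : inner (Lt (Rk j)) (S - Xk j) = inner (Rk j) (Rk j).
  by rewrite innerC -inner_adjoint -residual_error.
elim: k => [|k IHk]; first by rewrite direction0 grad.
rewrite directionS innerDl grad innerZl iterateS opprD addrA innerBr IHk innerZr.
rewrite !fnorm_sqr; have [P0|P_neq0] := eqVneq (Pk k) 0.
  (* Here the step length is 0, but the residual vanishes as well. *)
  by rewrite -IHk P0 !inner0l !(mulr0, subrr, addr0).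
by rewrite divfK ?inner_eq0 // subrr mulr0 addr0.
Qed.

Lemma direction_eq0 k : (Pk k == 0) = (Rk k == 0).
Proof.
apply/eqP/eqP => [P0|]; last exact: direction_eq0_of_residual.
by apply/eqP; rewrite -inner_eq0 -inner_direction_error P0 inner0l.
Qed.

Lemma alpha_direction k :
  alpha k * inner (Pk k) (Pk k) = inner (Rk k) (Rk k).
Proof.
rewrite !fnorm_sqr; have [P0|P_neq0] := eqVneq (Pk k) 0.
  by rewrite -inner_direction_error P0 !inner0l mulr0.
by rewrite divfK ?inner_eq0.
Qed.

(** In <R_(k+1), R_i> the operator is moved onto R_i, and L* R_i is a combination
    of P_i and P_(i-1); in <P_(k+1), P_i> it is moved onto P_i, and L P_i is a
    multiple of R_i - R_(i+1).  For i < k everything then vanishes by orthogonality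
    of the earlier stages; for i = k the coefficients alpha and beta are exactly
    those that cancel the remaining term. *)
Lemma stage_orthogonal k i :
  (i < k)%N -> inner (Rk k) (Rk i) = 0 /\ inner (Pk k) (Pk i) = 0.
Proof.
elim: k i => [//|k IHk].
have PR i : (i <= k)%N ->
    inner (Pk k) (Lt (Rk i)) = if i == k then inner (Pk k) (Pk k) else 0.
  case: i => [|i] le_ik.
    rewrite -direction0; case: (ltngtP 0%N k) le_ik => // [lt_0k|<-] //.
    by have [] := IHk 0%N lt_0k.
  have [_ Pki] := IHk i le_ik.
  have -> : Lt (Rk i.+1) = Pk i.+1 - beta i *: Pk i by rewrite directionS addrK.
  rewrite innerBr innerZr Pki mulr0 subr0.
  by case: (ltngtP i.+1 k) le_ik => // [lt_ik _|<- //]; have [] := IHk i.+1 lt_ik.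
have Rorth i : (i <= k)%N -> inner (Rk k.+1) (Rk i) = 0.
  move=> le_ik; rewrite residualS innerBl innerZl inner_adjoint PR //.
  case: ltngtP le_ik => // [lt_ik _|-> _]; last by rewrite alpha_direction subrr.
  by rewrite mulr0 subr0; have [] := IHk i lt_ik.
move=> i; rewrite ltnS => le_ik; split; first exact: Rorth.
have [R0|R_neq0] := eqVneq (Rk i) 0.
  (* The step length is 0 and cannot be divided by, but then P_i is 0 as well. *)
  by rewrite (direction_eq0_of_residual R0) inner0r.
have P_neq0 : Pk i != 0 by rewrite direction_eq0.
have alpha_neq0 : alpha i != 0.
  by rewrite !fnorm_sqr mulf_neq0 ?invr_eq0 ?inner_eq0.
apply: (mulfI alpha_neq0); rewrite mulr0 directionS innerDl mulrDr.
rewrite (innerC (Lt _)) -inner_adjoint -innerZl.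
have -> : alpha i *: L (Pk i) = Rk i - Rk i.+1 by rewrite residualS subKr.
rewrite innerBl (innerC (Rk i)) Rorth // sub0r innerZl.
case: ltngtP le_ik => // [lt_ik _|eq_ik _].
  have [_ ->] := IHk i lt_ik.
  by rewrite (innerC (Rk i.+1)) Rorth // !mulr0 oppr0 addr0.
rewrite eq_ik in R_neq0 *.
by rewrite mulrCA alpha_direction !fnorm_sqr divfK ?inner_eq0 // addNr.
Qed.

Lemma residual_vanishes : exists k, Rk k = 0.
Proof.
have [k /eqP] := @orthogonal_seq_vanishes _ _ _ _ _ (fun k => Pk k)
  (fun i j lt_ij => proj2 (stage_orthogonal lt_ij)).
by rewrite direction_eq0 => /eqP; exists k.
Qed.

Lemma algG_run_stage k :
  (forall j, (j < k)%N -> Rk j != 0) -> algG_run A C D X1 k.+1 (algG_stage k).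
Proof.
elim: k => [_|k IHk R_neq0]; first exact: algG_run1.
apply: algG_runS; first by apply: IHk => j lt_jk; apply: R_neq0; exact: ltnW.
have Rk_neq0 := R_neq0 k (ltnSn k).
case=> [/eqP|[_ /eqP]]; first by apply/negP.
by rewrite direction_eq0; apply/negP.
Qed.

Lemma algG_generates_ex : exists X, algG_generates A C D X1 X.
Proof.
have exR : exists k, Rk k == 0 by have [k /eqP] := residual_vanishes; exists k.
case: (ex_minnP exR) => k /eqP R0 kmin.
exists (Xk k), k.+1, (algG_stage k); split=> //; last by left.
apply: algG_run_stage => j lt_jk.
by apply: contraL lt_jk => /kmin; rewrite -leqNgt.
Qed.

End Consistent.

Lemma algG_run_stageE k s : algG_run A C D X1 k s -> exists j, s = algG_stage j.
Proof. by elim=> [|{}k {}s _ [j ->] _]; [exists 0%N | exists j.+1]. Qed.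

Lemma algG_generates_range_solution X :
    (exists W, X1 = Lt W) -> algG_generates A C D X1 X ->
  exists W, X = Lt W /\ sylvester_solution A C D (Lt W).
Proof.
move=> X1_range [k [s [/algG_run_stageE[j ->] _ R0 ->]]].
have [W XjW] := iterate_range j X1_range; exists W; split=> //.
by apply/esym/subr0_eq; rewrite -[_ + _ *e _]/(L (Lt W)) -XjW -residualE.
Qed.

End AlgorithmG.

(** * Convergence to the solution of least norm *)

Theorem theorem3p3 (R : realType) (M N : nat)
    (I : 'I_M -> nat) (J : 'I_N -> nat)
    (A : tensor R I I) (C : tensor R J J) (D : tensor R I J)
    (consistent : exists X : tensor R I J, sylvester_solution A C D X)
    (X1 : tensor R I J)
    (hX1 : (exists W : tensor R I J, X1 = ttr A *e W + W *e ttr C) \/ X1 = 0) :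
  exists X : tensor R I J,
    (forall Y : tensor R I J, algG_generates A C D X1 Y <-> Y = X) /\
    unique (least_norm_solution A C D) X.
Proof.
have X1_range : exists W, X1 = gradient_of A C W.
  by case: hX1 => [//|->]; exists 0; rewrite gradient_of_sylvester linear0.
have gen_least Y : algG_generates A C D X1 Y ->
    unique (least_norm_solution A C D) Y.
  move=> /(algG_generates_range_solution X1_range)[W [-> solW]].
  exact: range_solution_least_norm.
have [S solS] := consistent.
have [X genX] := algG_generates_ex X1 solS.
exists X; split; last exact: gen_least.
move=> Y; split=> [genY|-> //].
have [_ uniqX] := gen_least X genX; have [leastY _] := gen_least Y genY.
exact/esym/uniqX.
Qed.
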